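(* Let $\mathbb{F}$ be a field of arbitrary characteristic and let $\Delta$ be an $\mathbb{F}$-homology $(d-1)$-sphere with vertex set $[m]=\{1,\dots,m\}$. Let $\mathbf{k}=\mathbb{F}(a_{ij}:1\le i\le d,\ 1\le j\le m)$ be the field of rational functions in the independent variables $a_{ij}$, and let $\Theta=(\theta_1,\dots,\theta_d)$ with $\theta_i=\sum_{j=1}^m a_{ij}x_j$. Let $\mathbf{k}'=\mathbb{F}(a_{ij}:1\le i\le d,\ d+1\le j\le m)$, let $A=(a_{ij})_{1\le i\le d,\ d+1\le j\le m}$ be the corresponding $d\times(m-d)$ matrix, and let $\Theta'=(\theta_1',\dots,\theta_d')$ be the l.s.o.p. for $\mathbf{k}'[\Delta]$ whose coefficient matrix is $M_{\Theta'}=(I_d\mid A)$, where $I_d$ is the $d\times d$ identity matrix; that is, $\theta_i'=x_i+\sum_{j=d+1}^m a_{ij}x_j$. Then $\mathbf{k}(\Delta;\Theta)$ is anisotropic if and only if $\mathbf{k}'(\Delta;\Theta')$ is anisotropic.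
   Context: Homology spheres: for a field $\mathbb{F}$, a finite simplicial complex $\Delta$ is an $\mathbb{F}$-homology $d$-sphere if for every face $\sigma\in\Delta$ (including $\sigma=\emptyset$) the link $\mathrm{lk}_\sigma\Delta=\{\tau\in\Delta:\tau\cup\sigma\in\Delta,\ \tau\cap\sigma=\emptyset\}$ has the same homology with coefficients in $\mathbb{F}$ as the sphere $S^{d-|\sigma|}$, where $|\sigma|$ is the number of vertices of $\sigma$ (with $S^{-1}=\emptyset$, and the complex $\{\emptyset\}$ regarded as a $(-1)$-sphere). Face rings: for a field $K$ and a simplicial complex $\Delta$ with vertex set $[m]$, the face ring is $K[\Delta]=K[x_1,\dots,x_m]/I_\Delta$, graded by $\deg x_i=1$, where $I_\Delta$ is generated by the monomials $x_{i_1}\cdots x_{i_k}$ with $\{i_1,\dots,i_k\}\notin\Delta$. If $\dim\Delta=d-1$, a linear system of parameters (l.s.o.p.) for $K[\Delta]$ is a sequence $\Theta=(\theta_1,\dots,\theta_d)$ of $d$ linear forms such that $K(\Delta;\Theta):=K[\Delta]/(\Theta)$ is a finite-dimensional $K$-vector space; $K(\Delta;\Theta)$ is called an Artinian reduction of $K[\Delta]$, and $K(\Delta;\Theta)_i$ denotes its degree $i$ component. If $\theta_i=\sum_{j=1}^m c_{ij}x_j$, the associated $d\times m$ matrix is $M_\Theta=(c_{ij})$. Anisotropy: for a homology $(d-1)$-sphere $\Delta$, an Artinian reduction $K(\Delta;\Theta)$ is anisotropic if for every $i\le d/2$ and every nonzero $u\in K(\Delta;\Theta)_i$, the square $u^2\in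 K(\Delta;\Theta)_{2i}$ is nonzero. *)

(* Defs.v *)
From HB Require Import structures.
From mathcomp Require Import all_boot all_order all_algebra.
From mathcomp Require Import mpoly.

Set Implicit Arguments.
Unset Strict Implicit.
Unset Printing Implicit Defensive.

Import GRing.Theory.
Local Open Scope ring_scope.

Section Complexes.
Variable m : nat.
Implicit Types (D : {set {set 'I_m}}) (s t : {set 'I_m}).

Definition complex_on_vertices D : Prop :=
  [/\ set0 \in D,
      forall s t, s \in D -> t \subset s -> t \in D
    & forall v, [set v] \in D].

Definition link D s : {set {set 'I_m}} :=
  [set t in D | (t :|: s \in D) && [disjoint t & s]].

Section Homology.
Variable F : fieldType.

(* One ambient space for all chains: formal F-combinations of subsets of the
   vertex set, each subset oriented by the order of 'I_m. *)
Local Notation chain := {ffun {set 'I_m} -> F^o}.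

Definition simplex s : chain := [ffun t => (t == s)%:R].

Definition boundary (c : chain) : chain :=
  \sum_(s : {set 'I_m}) \sum_(v in s)
    (c s * (-1) ^+ #|[set u in s | (u < v)%N]|) *: simplex (s :\ v).

Fact boundary_linear : linear boundary.
Proof.
move=> a b c; rewrite /boundary scaler_sumr -big_split; apply: eq_bigr => s _.
rewrite scaler_sumr -big_split; apply: eq_bigr => v _ /=.
by rewrite !ffunE scalerA -scalerDl mulrDl mulrA.
Qed.
HB.instance Definition _ :=
  GRing.isLinear.Build F chain chain _ boundary boundary_linear.

(* The grading is by the number k of vertices, so chains D k sits in
   homological degree k - 1; the empty face is kept (k = 0), hence the
   homology is the reduced one. *)
Definition chains D (k : nat) : {vspace chain} :=
  <<[seq simplex s | s <- enum D & #|s| == k]>>%VS.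

Definition cycles D k : {vspace chain} :=
  (chains D k :&: lker (linfun boundary))%VS.

Definition boundaries D k : {vspace chain} :=
  (linfun boundary @: chains D k.+1)%VS.

(* The dimension over F of the reduced homology of D in degree k - 1; the
   truncated subtraction is exact since boundaries are cycles. *)
Definition reduced_betti D k : nat :=
  (\dim (cycles D k) - \dim (boundaries D k))%N.

(* D is an F-homology (d - 1)-sphere: the link of each face s has the reduced
   homology of the sphere of dimension d - 1 - #|s|, that is F in that degree
   (k = d - #|s|) and 0 elsewhere.  Taking s maximal, with link [set set0],
   this forces #|s| <= d for all faces. *)
Definition homology_sphere (d : nat) D : Prop :=
  forall s, s \in D -> forall k : nat,
    reduced_betti (link D s) k = (k + #|s| == d)%N.

End Homology.

Section FaceRing.
Variable K : fieldType.

Definition face_monomial s : {mpoly K[m]} := \prod_(j in s) 'X_j.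

Definition linear_form d (M : 'M[K]_(d, m)) (i : 'I_d) : {mpoly K[m]} :=
  \sum_j M i j *: 'X_j.

(* The ideal I_D + (Theta) of the polynomial ring, Theta being the linear forms
   with coefficient matrix M.  The quotient by it is K(D; Theta), and the
   component of degree i of the latter consists of the classes of the
   homogeneous polynomials of degree i. *)
Definition reduction_ideal D d (M : 'M[K]_(d, m)) (p : {mpoly K[m]}) : Prop :=
  exists (q : {set 'I_m} -> {mpoly K[m]}) (r : 'I_d -> {mpoly K[m]}),
    p = \sum_(s | s \notin D) q s * face_monomial s
        + \sum_i r i * linear_form M i.

(* dim D = d - 1 and K(D; Theta) is spanned over K by finitely many classes. *)
Definition is_lsop D d (M : 'M[K]_(d, m)) : Prop :=
  (\max_(s in D) #|s|)%N = d /\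
  exists (n : nat) (b : 'I_n -> {mpoly K[m]}),
    forall p, exists c : 'I_n -> K,
      reduction_ideal D M (p - \sum_i c i *: b i).

Definition anisotropic D d (M : 'M[K]_(d, m)) : Prop :=
  forall (i : nat) (u : {mpoly K[m]}),
    (i.*2 <= d)%N -> u \is i.-homog ->
    ~ reduction_ideal D M u -> ~ reduction_ideal D M (u ^+ 2).

End FaceRing.
End Complexes.

Definition ratfun (F : fieldType) (I : finType) : fieldType :=
  {fraction {mpoly F[#|I|]}}.

Definition ratvar (F : fieldType) (I : finType) (i : I) : ratfun F I :=
  tofrac 'X_(enum_rank i).

Section GenericMatrices.
Variables (F : fieldType) (d m : nat).

Definition generic_index : finType := ('I_d * 'I_m)%type.

Definition generic_mx : 'M[ratfun F generic_index]_(d, m) :=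
  \matrix_(i, j) ratvar F ((i, j) : generic_index).

(* Columns are numbered from 0: those of index j < d form the identity. *)
Definition normal_index : finType := ('I_d * {j : 'I_m | (d <= j)%N})%type.

Definition normal_generic_mx : 'M[ratfun F normal_index]_(d, m) :=
  \matrix_(i, j)
    if insub j is Some j' then ratvar F ((i, j') : normal_index)
    else (i == j :> nat)%:R.

End GenericMatrices.

(* Main.v *)
(* Write M_Theta = (B | A0) with B generic, hence invertible.  Since Artinian
   reductions only depend on the row space, M_Theta may be replaced by
   B^-1 M_Theta = (I | B^-1 A0), whose entries off I are algebraically
   independent; so k(D; Theta) is k'(D; Theta') extended along the embedding
   k' -> k sending A to B^-1 A0.  Ideal membership is a linear system over the
   base field, so anisotropy descends along any field extension.  Conversely it
   ascends along the purely transcendental extension k'(b)/k' (compare leading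
   coefficients in b), and k embeds in k'(b) by (B | A0) |-> b (I | A).

   Both systems are l.s.o.p.'s because all their maximal minors on facets are
   nonzero: a variable occurring twice in a monomial can be traded for variables
   outside a facet, so high-degree monomials vanish in the quotient. *)
From HB Require Import structures.
Require Import Defs.
From Stdlib Require Import Classical.
From mathcomp Require Import all_boot all_order all_algebra.
From mathcomp Require Import mpoly.

Set Implicit Arguments.
Unset Strict Implicit.
Unset Printing Implicit Defensive.

Import GRing.Theory.
Local Open Scope ring_scope.

(** * The ideal of an Artinian reduction and field extensions *)

Section ReductionIdeal.
Variables (K : fieldType) (m d : nat) (D : {set {set 'I_m}}) (M : 'M[K]_(d, m)).
Implicit Types p q : {mpoly K[m]}.

Lemma reduction_ideal0 : reduction_ideal D M 0.
Proof.
by exists (fun=> 0), (fun=> 0); rewrite !big1 ?addr0 // => *; rewrite mul0r.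
Qed.

Lemma reduction_idealD p q :
  reduction_ideal D M p -> reduction_ideal D M q -> reduction_ideal D M (p + q).
Proof.
move=> [q1 [r1 ->]] [q2 [r2 ->]].
exists (fun s => q1 s + q2 s), (fun i => r1 i + r2 i).
rewrite addrACA -!big_split /=.
by congr (_ + _); apply: eq_bigr => ? _; rewrite mulrDl.
Qed.

Lemma reduction_idealM p q :
  reduction_ideal D M q -> reduction_ideal D M (p * q).
Proof.
move=> [q1 [r1 ->]]; exists (fun s => p * q1 s), (fun i => p * r1 i).
rewrite mulrDr !mulr_sumr.
by congr (_ + _); apply: eq_bigr => ? _; rewrite mulrA.
Qed.

Lemma reduction_idealMr p q :
  reduction_ideal D M p -> reduction_ideal D M (p * q).
Proof. by rewrite mulrC; apply: reduction_idealM. Qed.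

Lemma reduction_idealZ c p :
  reduction_ideal D M p -> reduction_ideal D M (c *: p).
Proof. by rewrite -mul_mpolyC; apply: reduction_idealM. Qed.

Lemma reduction_idealB p q :
  reduction_ideal D M p -> reduction_ideal D M q -> reduction_ideal D M (p - q).
Proof.
by move=> Ip Iq; rewrite -scaleN1r; apply/reduction_idealD/reduction_idealZ.
Qed.

Lemma reduction_ideal_sum (I : eqType) (r : seq I) (P : pred I)
    (f : I -> {mpoly K[m]}) :
  (forall i, i \in r -> P i -> reduction_ideal D M (f i)) ->
  reduction_ideal D M (\sum_(i <- r | P i) f i).
Proof.
move=> If; rewrite big_seq_cond; apply: big_ind; first exact: reduction_ideal0.
  exact: reduction_idealD.
by move=> i /andP[ri Pi]; apply: If.
Qed.

Lemma reduction_ideal_face s :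
  s \notin D -> reduction_ideal D M (face_monomial K s).
Proof.
move=> sD; exists (fun t => (t == s)%:R), (fun=> 0).
rewrite [X in _ + X]big1 ?addr0 => [|i _]; last by rewrite mul0r.
rewrite (bigD1 s) //= eqxx mul1r big1 ?addr0 // => t /andP[_ /negPf ->].
by rewrite mul0r.
Qed.

Lemma reduction_ideal_form i : reduction_ideal D M (linear_form M i).
Proof.
exists (fun=> 0), (fun j => (j == i)%:R).
rewrite [X in X + _]big1 ?add0r => [|j _]; last by rewrite mul0r.
rewrite (bigD1 i) //= eqxx mul1r big1 ?addr0 // => t /negPf ->.
by rewrite mul0r.
Qed.

End ReductionIdeal.

Lemma linear_form_mul (K : fieldType) m d (B : 'M[K]_d) (M : 'M[K]_(d, m)) i :
  linear_form (B *m M) i = \sum_j B i j *: linear_form M j.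
Proof.
rewrite /linear_form; under [RHS]eq_bigr do rewrite scaler_sumr.
rewrite exchange_big; apply: eq_bigr => k _; rewrite mxE scaler_suml.
by apply: eq_bigr => j _; rewrite scalerA.
Qed.

Lemma reduction_ideal_mul (K : fieldType) m d D (B : 'M[K]_d)
    (M : 'M[K]_(d, m)) p :
  reduction_ideal D (B *m M) p -> reduction_ideal D M p.
Proof.
move=> [q [r ->]]; apply: reduction_idealD; apply: reduction_ideal_sum.
  by move=> s _ sD; apply/reduction_idealM/reduction_ideal_face.
move=> i _ _; apply: reduction_idealM; rewrite linear_form_mul.
apply: reduction_ideal_sum => j _ _.
exact/reduction_idealZ/reduction_ideal_form.
Qed.

(** Multiplying by any square matrix can only shrink the ideal; applying this to [B] and to its
    inverse gives both inclusions. *)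
Lemma reduction_ideal_unitmx (K : fieldType) m d D (B : 'M[K]_d)
    (M : 'M[K]_(d, m)) p :
  B \in unitmx -> reduction_ideal D (B *m M) p <-> reduction_ideal D M p.
Proof.
move=> uB; split; first exact: reduction_ideal_mul.
by rewrite -{1}(mulKmx uB M); apply: reduction_ideal_mul.
Qed.

Lemma anisotropic_unitmx (K : fieldType) m d D (B : 'M[K]_d)
    (M : 'M[K]_(d, m)) :
  B \in unitmx -> anisotropic D (B *m M) <-> anisotropic D M.
Proof.
by move=> uB; split=> aM i u id hu; have := aM i u id hu;
  rewrite !(reduction_ideal_unitmx _ _ _ uB).
Qed.

(** * Base change of the ideal along a field extension *)

Section Extension.
Variables (K L : fieldType) (phi : {rmorphism K -> L}).
Variables (m d : nat) (D : {set {set 'I_m}}) (M : 'M[K]_(d, m)).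

Lemma map_mpoly_face (s : {set 'I_m}) :
  map_mpoly phi (face_monomial K s) = face_monomial L s.
Proof.
by rewrite rmorph_prod /=; apply: eq_bigr => i _; rewrite map_mpolyX.
Qed.

Lemma map_mpoly_form i :
  map_mpoly phi (linear_form M i) = linear_form (map_mx phi M) i.
Proof.
rewrite raddf_sum /=; apply: eq_bigr => j _.
by rewrite map_mpolyZ map_mpolyX mxE.
Qed.

Lemma reduction_ideal_map p :
  reduction_ideal D M p -> reduction_ideal D (map_mx phi M) (map_mpoly phi p).
Proof.
move=> [q [r ->]]; rewrite rmorphD !rmorph_sum /=.
apply: reduction_idealD; apply: reduction_ideal_sum => i _ Pi; rewrite rmorphM.
  by rewrite /= map_mpoly_face; apply/reduction_idealM/reduction_ideal_face.
by rewrite /= map_mpoly_form; apply/reduction_idealM/reduction_ideal_form.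
Qed.

(** Each multiplier is expanded into monomials: its coefficients supply the scalars of [L], and the
    monomials, defined over [K], are absorbed into the generators of the ideal. *)
Lemma reduction_ideal_map_span p :
  reduction_ideal D (map_mx phi M) p ->
  exists2 s : seq (L * {mpoly K[m]}),
    forall x, x \in s -> reduction_ideal D M x.2
    & p = \sum_(x <- s) x.1 *: map_mpoly phi x.2.
Proof.
pose spanned p := exists2 s : seq (L * {mpoly K[m]}),
    forall x, x \in s -> reduction_ideal D M x.2
    & p = \sum_(x <- s) x.1 *: map_mpoly phi x.2.
have spanned0 : spanned 0 by exists [::] => //; rewrite big_nil.
have spannedD p1 p2 : spanned p1 -> spanned p2 -> spanned (p1 + p2).
  move=> [s1 I1 ->] [s2 I2 ->]; exists (s1 ++ s2); last by rewrite big_cat.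
  by move=> x; rewrite mem_cat => /orP[/I1|/I2].
have spannedM q g : reduction_ideal D M g -> spanned (q * map_mpoly phi g).
  move=> Ig; exists [seq (q@_t, 'X_[t] * g) | t <- msupp q].
    by move=> x /mapP[t _ ->]; apply: reduction_idealM.
  rewrite big_map {1}[q]mpolyE mulr_suml; apply: eq_bigr => t _ /=.
  by rewrite rmorphM /= map_mpolyX scalerAl.
move=> [q [r ->]]; apply: (spannedD); apply: big_ind => // i sD.
  by rewrite -map_mpoly_face; apply/spannedM/reduction_ideal_face.
by rewrite -map_mpoly_form; apply/spannedM/reduction_ideal_form.
Qed.

(** Membership becomes a linear system with coefficients in [K]. A solution over [L] yields one over
    [K] because inclusion of row spaces is insensitive to field extension. *)
Lemma reduction_ideal_descent p :
  reduction_ideal D (map_mx phi M) (map_mpoly phi p) -> reduction_ideal D M p.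
Proof.
move=> /reduction_ideal_map_span[s Is Ep].
(* [k] exceeds every degree that occurs, so the polynomials involved are rows indexed by the
   finitely many monomials of degree below [k]. *)
pose k := \max_(t <- msupp p ++ flatten [seq msupp x.2 | x <- s]) (mdeg t).+1.
have lek (t : 'X_{1..m}) :
    t \in msupp p ++ flatten [seq msupp x.2 | x <- s] -> (mdeg t < k)%N.
  by move=> ht; rewrite /k (big_rem _ ht) /= leq_max leqnn.
pose T : finType := 'X_{1..m < k}.
pose row q : 'rV[K]_#|T| := \row_j q@_(bmnm (enum_val j)).
pose A : 'M[K]_(size s, #|T|) := \matrix_i row (nth (0, 0) s i).2.
have /submxP[w Ew] : (row p <= A)%MS.
  rewrite -(map_submx phi); apply/submxP.
  exists (\row_i (nth (0, 0) s i).1); apply/rowP => j; rewrite !mxE.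
  rewrite -mcoeff_map_mpoly Ep (big_nth (0, 0)) big_mkord raddf_sum /=.
  by apply: eq_bigr => i _; rewrite mcoeffZ mcoeff_map_mpoly !mxE.
suff -> : p = \sum_i w 0 i *: (nth (0, 0) s i).2.
  apply: reduction_ideal_sum => i _ _; apply: reduction_idealZ; apply: Is.
  exact: mem_nth.
apply/mpolyP => t; have [ltk|lekt] := ltnP (mdeg t) k.
  have := congr1 (fun v : 'rV_#|T| => v 0 (enum_rank (BMultinom ltk))) Ew.
  rewrite !mxE enum_rankK /= => ->; rewrite raddf_sum /=.
  by apply: eq_bigr => i _; rewrite mcoeffZ !mxE enum_rankK.
have out (q : {mpoly K[m]}) :
    {subset msupp q <= msupp p ++ flatten [seq msupp x.2 | x <- s]} -> q@_t = 0.
  move=> sub; apply/eqP; rewrite mcoeff_eq0; apply: contraL lekt => /sub/lek.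
  by rewrite -ltnNge.
rewrite raddf_sum /= out ?big1 // => [i _|t' ht']; last by rewrite mem_cat ht'.
rewrite mcoeffZ out ?mulr0 // => t' ht'; rewrite mem_cat; apply/orP; right.
by apply/flattenP; exists (msupp (nth (0, 0) s i).2) => //; apply/map_f/mem_nth.
Qed.

Lemma anisotropic_descent : anisotropic D (map_mx phi M) -> anisotropic D M.
Proof.
move=> aM i u id hu nu /reduction_ideal_map; rewrite rmorphXn /=.
apply: (aM i) => //; last by move/reduction_ideal_descent.
apply/dhomogP => t; rewrite (perm_mem (msupp_map_mpoly _ (fmorph_inj phi))).
by move: t; apply/dhomogP.
Qed.

End Extension.

(** * Fraction fields *)

Section Fractions.

Local Notation tofrac := (@FracField.tofrac _).

Lemma fracE (R : idomainType) (x : {fraction R}) :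
  x = tofrac \n_(repr x) / tofrac \d_(repr x).
Proof.
set y := repr x; have nz : tofrac \d_y != 0 by rewrite tofrac_eq0 denom_ratioP.
rewrite -[LHS]reprK -/y; apply: (mulIf nz); rewrite divfK //.
unlock FracField.tofrac; rewrite -[LHS]FracField.pi_mul.
apply/eqmodP; rewrite /= FracField.equivfE /FracField.mulf.
by rewrite !numden_Ratio ?mulf_neq0 ?oner_eq0 ?denom_ratioP // !mulr1 mulrC.
Qed.

Lemma fracP (R : idomainType) (x : {fraction R}) :
  exists n e, e != 0 /\ x = tofrac n / tofrac e.
Proof.
exists (\n_(repr x)), (\d_(repr x)).
by split; [apply: denom_ratioP | apply: fracE].
Qed.

(** Universal property of the fraction field: injectivity keeps the images of denominators
    nonzero. *)
Lemma frac_lift (R : idomainType) (L : fieldType) (f : {rmorphism R -> L}) :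
  injective f ->
  exists g : {rmorphism {fraction R} -> L}, forall x, g (tofrac x) = f x.
Proof.
move=> injf.
have f0 x : x != 0 -> f x != 0 by rewrite -(rmorph0 f) (inj_eq injf).
pose g (x : {fraction R}) : L := f \n_(repr x) / f \d_(repr x).
(* Cross-multiplication shows that the chosen representative does not matter, so both morphism laws
   become identities between fractions. *)
have gE n e : e != 0 -> g (tofrac n / tofrac e) = f n / f e.
  move=> nz; rewrite /g; set x : {fraction R} := tofrac n / tofrac e; 
  have /eqP : tofrac \n_(repr x) / tofrac \d_(repr x) = tofrac n / tofrac e.
    by rewrite -fracE.
  rewrite eqr_div ?tofrac_eq0 ?denom_ratioP //.
  rewrite -!rmorphM tofrac_eq => /eqP E.
  by apply/eqP; rewrite eqr_div ?f0 ?denom_ratioP // -!rmorphM E.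
have gB : zmod_morphism g.
  move=> x y; case: (fracP x) (fracP y) => [a [b [b0 ->]]] [c [e [e0 ->]]].
  rewrite -mulNr -rmorphN addf_div ?tofrac_eq0 // -!rmorphM -rmorphD.
  rewrite !gE ?mulf_neq0 // -mulNr addf_div ?f0 //.
  by rewrite rmorphD !rmorphM rmorphN.
have gM : monoid_morphism g.
  split.
    by rewrite -(divr1 1) -(rmorph1 tofrac) gE ?oner_eq0 // rmorph1 divr1.
  move=> x y; case: (fracP x) (fracP y) => [a [b [b0 ->]]] [c [e [e0 ->]]].
  rewrite mulf_div -!rmorphM !gE ?mulf_neq0 //.
  by rewrite mulf_div !rmorphM.
pose gz := GRing.isZmodMorphism.Build _ _ g gB.
pose gm := GRing.isMonoidMorphism.Build _ _ g gM.
pose h : {rmorphism {fraction R} -> L} := HB.pack g gz gm.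
exists h => x; rewrite /h /=.
by rewrite -[tofrac x]divr1 -(rmorph1 tofrac) gE ?oner_eq0 // rmorph1 divr1.
Qed.

End Fractions.

(** * Purely transcendental extensions *)

Section LeadingCoefficient.
Import Order.TTheory.
Variables (R : comNzRingType) (n : nat) (I : R -> Prop).
Hypotheses (I0 : I 0) (ID : forall a b, I a -> I b -> I (a + b)).
Hypothesis IM : forall a b, I b -> I (a * b).
Implicit Types (v w : {mpoly R[n]}) (a b c : 'X_{1..n}).

Lemma mcoeffM_ideal v w :
  (forall c, I w@_c) -> forall c, I (v * w)@_c.
Proof.
by move=> Iw c; rewrite mcoeffM; apply: big_ind => // k _; apply: IM.
Qed.

(** Modulo the ideal [I], the exponents of [v] and [w] are at most [a] and [b]. A pair of exponents
    with sum [a + b] other than [a, b] has an entry above its bound, so only the product of the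
    leading coefficients survives. *)
Lemma mcoeffM_lead v w a b :
  (forall c, (a < c)%O -> I v@_c) -> (forall c, (b < c)%O -> I w@_c) ->
  (forall c, ((a + b)%MM < c)%O -> I (v * w)@_c) /\
  exists2 z, I z & (v * w)@_(a + b) = v@_a * w@_b + z.
Proof.
move=> Iv Iw.
have IMr x y : I x -> I (x * y) by rewrite mulrC; apply: IM.
split=> [c ltc|].
  rewrite mcoeffM; apply: big_ind => // k /eqP Ec.
  have [/Iv/IMr //|lea] := ltP a (k.1 : 'X_{1..n}).
  have [/Iw/IM //|leb] := ltP b (k.2 : 'X_{1..n}).
  by have := lem_add lea leb; rewrite -Ec leNgt ltc.
have lta : (mdeg a < (mdeg (a + b)%MM).+1)%N by rewrite mdegD ltnS leq_addr.
have ltb : (mdeg b < (mdeg (a + b)%MM).+1)%N by rewrite mdegD ltnS leq_addl.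
rewrite mcoeffM (bigD1 (BMultinom lta, BMultinom ltb)) //=.
eexists; last by [].
apply: big_ind => // k /andP[/eqP Ec neq].
have [/Iv/IMr //|lea] := ltP a (k.1 : 'X_{1..n}).
have [/Iw/IM //|leb] := ltP b (k.2 : 'X_{1..n}).
case/eqP: neq; case: k Ec lea leb => k1 k2 /= Ec lea leb.
have Ea : k1 = a :> 'X_{1..n}.
  apply/eqP; rewrite eq_le lea leNgt; apply/negP => lt1.
  by have := ltmc_le_add lt1 leb; rewrite -Ec ltxx.
congr (_, _); apply: val_inj => //=.
apply: (@addmI _ a).
exact: etrans (congr1 (fun x => (x + k2)%MM) (esym Ea)) (esym Ec).
Qed.

End LeadingCoefficient.

(** * Ascent of anisotropy to a field of rational functions *)

Section PurelyTranscendental.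
Import Order.TTheory.
Variables (K : fieldType) (n m d : nat).
Variables (D : {set {set 'I_m}}) (M : 'M[K]_(d, m)).
Local Notation P := {mpoly K[n]}.
Variables (L : fieldType) (frac : {rmorphism P -> L}).
Hypothesis frac_inj : injective frac.
Hypothesis fracP : forall x, exists a e, e != 0 /\ x = frac a / frac e.
Local Notation S := {mpoly {mpoly K[m]}[n]}.

Let frac_eq0 x : (frac x == 0) = (x == 0).
Proof. by rewrite -(inj_eq frac_inj) rmorph0. Qed.

Definition const_frac : {rmorphism K -> L} := frac \o @mpolyC n K.

(** Interchanges the two layers of variables: a polynomial in the new variables over [K[x]] is read
    as a polynomial in the [x] over [L]. *)
Definition frac_coeffs : {rmorphism S -> {mpoly L[m]}} :=
  mmap (map_mpoly const_frac) (fun j => (frac 'X_j)%:MP).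

Lemma mcoeff_frac_coeffs w t :
  (frac_coeffs w)@_t = frac (map_mpoly (mcoeff t) w).
Proof.
rewrite raddf_sum [in RHS]/map_mpoly /mmap rmorph_sum /=.
apply: eq_bigr => a _; rewrite rmorphM /=.
have -> : mmap1 (fun j => (frac ('X_j : P))%:MP_[m]) a = (frac 'X_[a])%:MP.
  rewrite /mmap1 mpolyXE_id !rmorph_prod /=; apply: eq_bigr => j _.
  by rewrite !rmorphXn.
by rewrite mulrC mcoeffCM mcoeff_map_mpoly mmap1_id mulrC.
Qed.

Lemma frac_coeffs_inj : injective frac_coeffs.
Proof.
move=> v w Evw; apply/mpolyP => a; apply/mpolyP => t.
have : frac (map_mpoly (mcoeff t) v) = frac (map_mpoly (mcoeff t) w).
  by rewrite -!mcoeff_frac_coeffs Evw.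
move=> /frac_inj/(congr1 (mcoeff a)).
by rewrite !mcoeff_map_mpoly.
Qed.

Lemma frac_coeffs_scale (g : P) :
  frac_coeffs (map_mpoly (@mpolyC m K) g) = (frac g)%:MP.
Proof.
apply/mpolyP => t; rewrite mcoeff_frac_coeffs (mcoeffC (frac g) t).
case: (t =P 0%MM) => [->|/eqP/negPf t0]; rewrite ?mulr1 ?mulr0.
  congr (frac _); apply/mpolyP => a; rewrite !mcoeff_map_mpoly /= mcoeffC eqxx.
  exact: mulr1.
suff -> : map_mpoly (mcoeff t) (map_mpoly (@mpolyC m K) g) = 0.
  by rewrite rmorph0.
by apply/mpolyP => a; rewrite !mcoeff_map_mpoly /= mcoeff0 mcoeffC t0 mulr0.
Qed.

Lemma frac_coeffsC q : frac_coeffs q%:MP = map_mpoly const_frac q.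
Proof. by rewrite /frac_coeffs /= mmapC. Qed.

Lemma frac_coeffsZ (g : P) w :
  frac_coeffs (map_mpoly (@mpolyC m K) g * w) = frac g *: frac_coeffs w.
Proof. by rewrite (rmorphM frac_coeffs) frac_coeffs_scale mul_mpolyC. Qed.

Lemma reduction_ideal_frac_coeffs w :
  (forall a, reduction_ideal D M w@_a) ->
  reduction_ideal D (map_mx const_frac M) (frac_coeffs w).
Proof.
move=> Iw; apply: reduction_ideal_sum => a _ _; apply: reduction_idealMr.
exact: reduction_ideal_map.
Qed.

(** Used both with [Q] homogeneity of a fixed degree and with [Q] membership in the ideal; the
    cleared polynomial [w] keeps the property coefficientwise. *)
Lemma clear_denominators (Q : {mpoly K[m]} -> Prop)
    (s : seq (L * {mpoly K[m]})) :
  Q 0 -> (forall p q, Q p -> Q q -> Q (p + q)) ->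
  (forall c p, Q p -> Q (c *: p)) -> (forall x, x \in s -> Q x.2) ->
  exists g w, [/\ g != 0, forall a, Q w@_a &
    frac g *: \sum_(x <- s) x.1 *: map_mpoly const_frac x.2 = frac_coeffs w].
Proof.
move=> Q0 QD QZ; elim: s => [|[c q] s IH] Qs.
  exists 1, 0; split=> [|a|]; rewrite ?oner_eq0 ?mcoeff0 //.
  by rewrite big_nil scaler0 rmorph0.
have [|g [w [g0 Qw Ew]]] := IH.
  by move=> x sx; apply: Qs; rewrite inE sx orbT.
have Qq : Q q by apply: (Qs (c, q)); rewrite mem_head.
have [a [e [e0 Ec]]] := fracP c.
(* With [c = a / e] and the tail cleared to [w] by [g], the factor [g * e] clears the whole sum to
   [g * a * q + e * w]. *)
exists (g * e), (map_mpoly (@mpolyC m K) (g * a) * q%:MP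
                 + map_mpoly (@mpolyC m K) e * w); split.
- by rewrite mulf_neq0.
- move=> b; rewrite mcoeffD; apply: (QD).
    by rewrite mulrC mcoeffCM mcoeff_map_mpoly mulrC mul_mpolyC; apply: QZ.
  rewrite mcoeffM; apply: (big_ind Q Q0 QD) => k _.
  by rewrite mcoeff_map_mpoly mul_mpolyC; apply: QZ.
rewrite big_cons (rmorphD frac_coeffs) !frac_coeffsZ frac_coeffsC -Ew.
rewrite scalerDr !scalerA Ec (rmorphM frac g e) (rmorphM frac g a).
congr (_ *: _ + _ *: _); last by rewrite mulrC.
by rewrite mulrACA divff ?frac_eq0 // mulr1.
Qed.

(** Clearing denominators, [g u = w] and [h u^2 = v] give [h w^2 = g^2 v], whose coefficients lie in
    the ideal. If [a] were the largest exponent with [w@_a] outside the ideal, comparing leading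
    coefficients modulo the ideal would put the square of [w@_a] inside it, against anisotropy over
    [K]. *)
Lemma anisotropic_frac : anisotropic D M -> anisotropic D (map_mx const_frac M).
Proof.
move=> aM i u id /dhomogP hu nu Iu2; apply: nu.
have Eu : u = \sum_(x <- [seq (u@_t, 'X_[t]) | t <- msupp u])
                x.1 *: map_mpoly const_frac x.2.
  rewrite big_map {1}[u]mpolyE; apply: eq_bigr => t _ /=.
  by rewrite map_mpolyX.
have [||||g [w [g0 hw Ew]]] := @clear_denominators (fun q => q \is i.-homog)
    [seq (u@_t, 'X_[t]) | t <- msupp u].
- exact: dhomog0.
- exact: dhomogD.
- by move=> c p; apply: dhomogZ.
- by move=> x /mapP[t /hu ht ->] /=; rewrite dhomogX ht.
have [s Is E2] := reduction_ideal_map_span Iu2.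
have [|||h [v [h0 Iv Ev]]] := clear_denominators _ _ _ Is.
- exact: reduction_ideal0.
- exact: reduction_idealD.
- exact: reduction_idealZ.
rewrite -{}Eu in Ew; rewrite -{}E2 in Ev.
pose scal (q : P) : S := map_mpoly (@mpolyC m K) q.
have Ehw : scal h * (w * w) = scal (g ^+ 2) * v.
  apply: frac_coeffs_inj; rewrite !frac_coeffsZ.
  rewrite (rmorphM frac_coeffs w w) -Ew -Ev.
  by rewrite -scalerAl -scalerAr !scalerA rmorphXn -mulrA -!expr2 mulrC.
suff Iw a : reduction_ideal D M w@_a.
  have -> : u = (frac g)^-1 *: frac_coeffs w.
    by rewrite -Ew scalerA mulVf ?frac_eq0 // scale1r.
  by apply: reduction_idealZ; apply: reduction_ideal_frac_coeffs.
(* Descending induction on [a]: the measure counts the support monomials of [w] above [a]. *)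
have [k] := ubnP (count (fun b => (a < b)%O) (msupp w)).
elim: k a => // k IH a ltk.
have Iw_gt b : (a < b)%O -> reduction_ideal D M w@_b.
  move=> ltab; have [wb|/memN_msupp_eq0 ->] := boolP (b \in msupp w);
    last exact: reduction_ideal0.
  apply: IH; rewrite ltnS in ltk; apply: leq_trans ltk.
  have := count_predUI (fun c => (b < c)%O) (pred1 b) (msupp w).
  rewrite (count_uniq_mem _ (msupp_uniq w)) wb addn1.
  rewrite [X in (_ + X)%N](@eq_count _ _ pred0)
    ?count_pred0 ?addn0 => [<-|c /=].
    by apply: sub_count => c /orP[/(lt_trans ltab)|/eqP ->].
  by case: eqP => [->|]; rewrite ?ltxx ?andbF.
apply: NNPP => nIw; apply: (aM i _ id (hw a) nIw).
have I0 := reduction_ideal0 D M; have ID := @reduction_idealD _ _ _ D M.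
have IM := @reduction_idealM _ _ _ D M.
have [w2_gt [z2 Iz2 E2]] := mcoeffM_lead I0 ID IM Iw_gt Iw_gt.
have h_gt b : (mlead h < b)%O -> reduction_ideal D M (scal h)@_b.
  by move=> /mcoeff_gt_mlead hb; rewrite mcoeff_map_mpoly /= hb mpolyC0.
have [_ [z3 Iz3 E3]] := mcoeffM_lead I0 ID IM h_gt w2_gt.
(* At this exponent [h w^2] has, modulo the ideal, the square of [w@_a] times the leading
   coefficient of [h], a nonzero scalar of [K] that can be cancelled. *)
have := mcoeffM_ideal I0 ID IM (scal (g ^+ 2)) Iv (mlead h + (a + a))%MM.
rewrite -Ehw E3 => /(fun H => reduction_idealB H Iz3); rewrite addrK.
rewrite mcoeff_map_mpoly mul_mpolyC => /(reduction_idealZ (mleadc h)^-1).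
rewrite scalerA mulVf ?mleadc_eq0 // scale1r E2.
by move=> /(fun H => reduction_idealB H Iz2); rewrite addrK expr2.
Qed.

End PurelyTranscendental.

(** * Homology spheres and linear systems of parameters *)

(** This is the link of a facet: the empty face is a cycle, and there is no vertex whose boundary
    could kill it. *)
Lemma reduced_betti_empty_face (F : fieldType) m :
  reduced_betti F [set set0 : {set 'I_m}] 0 = 1%N.
Proof.
have -> : reduced_betti F [set set0 : {set 'I_m}] 0 =
    (\dim (<[simplex F (set0 : {set 'I_m})]> :&: lker (linfun (@boundary m F)))
     - \dim (linfun (@boundary m F) @: 0))%N.
  rewrite /reduced_betti /cycles /boundaries /chains enum_set1 /= cards0 /=.
  by rewrite span_seq1 span_nil.
have nz : simplex F (set0 : {set 'I_m}) != 0.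
  apply/eqP => /ffunP/(_ set0); rewrite !ffunE eqxx => /eqP.
  by rewrite oner_eq0.
rewrite limg0 dimv0 subn0 (capv_idPl _) ?dim_vline ?nz //.
rewrite -memvE memv_ker lfunE /= /boundary; apply/eqP; apply: big1 => s _.
apply: big1 => v vs; rewrite ffunE; case: eqP => [s0|_].
  by rewrite s0 inE in vs.
by rewrite mul0r scale0r.
Qed.

(** A maximal face [t] above [s] has the empty face alone as its link, whose Betti number 1 at
    [k = 0] forces [#|t| = d]. *)
Lemma homology_sphere_pure (F : fieldType) d m (D : {set {set 'I_m}}) s :
  set0 \in D -> homology_sphere F d D -> s \in D ->
  exists t, [/\ t \in D, s \subset t & #|t| = d].
Proof.
move=> D0 sphD sD.
have [t /maxsetP[tD tmax] st] : {t | maxset (mem D) t & s \subset t}.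
  exact: maxset_exists.
rewrite /= in tD; exists t; split=> //.
have := sphD t tD 0%N; suff -> : link D t = [set set0].
  by rewrite reduced_betti_empty_face add0n; case: eqP.
apply/setP => r; rewrite !inE; apply/andP/eqP => [[rD /andP[rtD dis]]|->].
  have rt : r \subset t by rewrite -(tmax _ rtD) ?subsetUl ?subsetUr.
  by apply/eqP; rewrite -setI_eq0 (setIidPl rt) in dis.
by split; [|rewrite set0U tD disjoints_subset sub0set].
Qed.

(** * Invertible maximal minors give a linear system of parameters *)

Section Lsop.
Variables (K : fieldType) (d m : nat) (D : {set {set 'I_m}}) (M : 'M[K]_(d, m)).
Hypothesis D0 : set0 \in D.
Hypothesis pureD :
  forall s, s \in D -> exists t, [/\ t \in D, s \subset t & #|t| = d].
Hypothesis minorM :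
  forall e : 'I_d -> 'I_m, injective e -> colsub e M \in unitmx.

Let card_face s : s \in D -> (#|s| <= d)%N.
Proof. by move=> /pureD[t [_ st <-]]; apply: subset_leq_card. Qed.

Lemma eliminate_variable (t : {set 'I_m}) v : #|t| = d -> v \in t ->
  exists c : 'I_m -> K,
    reduction_ideal D M ('X_v - \sum_(u | u \notin t) c u *: 'X_u).
Proof.
move=> td vt.
pose e i := enum_val (cast_ord (esym td) i).
have inje : injective e by move=> i j /enum_val_inj/cast_ord_inj.
have [i0 Ei0] : exists i, e i = v.
  exists (cast_ord td (enum_rank_in vt v)).
  by rewrite /e cast_ordK enum_rankK_in.
(* The combination of the rows of [M] with weights [w] restricts on [t] to the indicator of [v], so
   it expresses ['X_v] through variables outside [t]. *)
pose w := row i0 (invmx (colsub e M)).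
have wM u : u \in t -> (w *m M) 0 u = (u == v)%:R.
  move=> ut; have [i <-] : exists i, e i = u.
    exists (cast_ord td (enum_rank_in ut u)).
    by rewrite /e cast_ordK enum_rankK_in.
  rewrite -Ei0 (inj_eq inje).
  have := congr1 (fun A : 'M_d => A i0 i) (mulVmx (minorM inje)).
  rewrite mulmx_colsub !mxE eq_sym => <-.
  by apply: eq_bigr => j _; rewrite !mxE.
exists (fun u => - (w *m M) 0 u).
suff -> : 'X_v - \sum_(u | u \notin t) - (w *m M) 0 u *: 'X_u =
    \sum_j w 0 j *: linear_form M j.
  apply: reduction_ideal_sum => j _ _.
  exact/reduction_idealZ/reduction_ideal_form.
transitivity (\sum_u (w *m M) 0 u *: 'X_u : {mpoly K[m]}).
  rewrite [RHS](bigID (mem t)) /=; congr (_ + _).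
    rewrite (bigD1 v) //= wM // eqxx scale1r big1 ?addr0 // => u.
    by move=> /andP[ut /negPf uv]; rewrite wM // uv scale0r.
  by rewrite -sumrN; apply: eq_bigr => u _; rewrite scaleNr opprK.
rewrite /linear_form; under [RHS]eq_bigr do rewrite scaler_sumr.
rewrite exchange_big; apply: eq_bigr => u _; rewrite mxE scaler_suml.
by apply: eq_bigr => j _; rewrite scalerA.
Qed.

Definition msupport (a : 'X_{1..m}) : {set 'I_m} := [set i | a i != 0%N].

Lemma reduction_ideal_nonface (a : 'X_{1..m}) :
  msupport a \notin D -> reduction_ideal D M 'X_[a].
Proof.
(* The squarefree part of the monomial, which divides it and is the face monomial of its support. *)
move=> aD; pose f := (\sum_(i in msupport a) U_(i))%MM.
have lefa : (f <= a)%MM.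
  apply/mnm_lepP => i; rewrite /f mnm_sumE.
  have [ia|ia] := boolP (i \in msupport a).
    rewrite (bigD1 i) //= mnm1E eqxx big1 ?addn0.
      by rewrite inE in ia; rewrite lt0n.
    by move=> j /andP[_ /negPf ji]; rewrite mnm1E ji.
  rewrite big1 // => j ja; rewrite mnm1E; case: eqP => // ji.
  by rewrite -ji ja in ia.
rewrite -(submK lefa) mpolyXD; apply: reduction_idealM.
have -> : 'X_[f] = face_monomial K (msupport a).
  exact: (big_morph _ (@mpolyXD m K) (mpolyX0 m K)).
exact: reduction_ideal_face.
Qed.

(* A variable with exponent at least 2 can be traded for variables outside a
   facet containing the support, which enlarges the support. *)
Lemma reduction_ideal_high_degree (a : 'X_{1..m}) :
  (d < mdeg a)%N -> reduction_ideal D M 'X_[a].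
Proof.
(* Induction on the number of vertices outside the support. *)
have [k] := ubnP (m - #|msupport a|).
elim: k a => // k IH a ltk lta.
have [aD|] := boolP (msupport a \in D); last exact: reduction_ideal_nonface.
have [t [tD sat td]] := pureD aD.
(* The degree exceeds [d], which bounds the size of the support, so some exponent is at least 2. *)
have /existsP[v v2] : [exists v, 1 < a v]%N.
  apply: contraTT lta => /existsPn small; rewrite -leqNgt mdegE.
  apply: leq_trans (card_face aD); rewrite -sum1_card [leqRHS]big_mkcond /=.
  apply: leq_sum => i _; have := small i; rewrite inE.
  by case: (a i) => [|[]].
have va : v \in msupport a by rewrite inE -lt0n ltnW.
have [c Ic] := eliminate_variable td (subsetP sat v va).
have leva : (U_(v) <= a)%MM by rewrite lep1mP -lt0n ltnW.
rewrite -(submK leva) mpolyXD -(subrK (\sum_(u | u \notin t) c u *: 'X_u) 'X_v).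
rewrite mulrDr; apply: reduction_idealD; first exact: reduction_idealM.
rewrite mulr_sumr; apply: reduction_ideal_sum => u _ ut.
rewrite -scalerAr -mpolyXD; apply/reduction_idealZ/IH; last first.
  by rewrite mdegD mdeg1 -(mdeg1 v) -mdegD submK.
have us : u \notin msupport a by apply: contra ut; apply: (subsetP sat).
(* [v] stays in the support because its exponent was at least 2. *)
have sub : u |: msupport a \subset msupport (a - U_(v) + U_(u))%MM.
  apply/subsetP => i; rewrite !inE mnmDE mnmBE !mnm1E.
  case: (i =P u) => [->|_] /=; first by rewrite eqxx addn1.
  case: (v =P i) => [<- _|_]; first by rewrite -lt0n ltn_addr // subn_gt0.
  by rewrite subn0 -!lt0n => h; rewrite ltn_addr.
have := subset_leq_card sub; rewrite cardsU1 us add1n => lt1.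
have lem : (#|msupport a| < m)%N.
  by have := max_card (mem (u |: msupport a)); rewrite card_ord cardsU1 us.
by rewrite ltnS in ltk; apply: leq_trans ltk; apply: ltn_sub2l.
Qed.

(** Purity fixes the dimension, and the monomials of degree at most [d] span the quotient since all
    others lie in the ideal. *)
Lemma lsop_minors : is_lsop D M.
Proof.
split.
  apply/eqP; rewrite eqn_leq; apply/andP; split.
    by apply/bigmax_leqP => s /card_face.
  have [t [tD _ <-]] := pureD D0.
  exact: (@leq_bigmax_cond _ (mem D) (fun s : {set 'I_m} => #|s|)).
pose T : finType := 'X_{1..m < d.+1}.
exists #|T|, (fun i => 'X_[bmnm (enum_val i)]) => p.
exists (fun i => p@_(bmnm (enum_val i))).
set q := p - _; rewrite [q]mpolyE; apply: reduction_ideal_sum => a aq _.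
apply/reduction_idealZ/reduction_ideal_high_degree.
rewrite ltnNge -ltnS; apply: contraTN aq => lta.
rewrite -mcoeff_eq0 /q mcoeffB raddf_sum /= subr_eq0; apply/eqP.
rewrite (bigD1 (enum_rank (BMultinom lta))) //= enum_rankK /=.
rewrite mcoeffZ mcoeffX eqxx mulr1 big1 ?addr0 // => j neq.
rewrite mcoeffZ mcoeffX; case: eqP => [Ea|_]; last by rewrite mulr0.
case/eqP: neq; apply: enum_val_inj; rewrite enum_rankK; exact: val_inj.
Qed.

End Lsop.

(** * Generic matrices *)

Lemma eq_rmorph_mpoly n (R : nzRingType) (S : comNzRingType)
    (f g : {rmorphism {mpoly R[n]} -> S}) :
  (forall c, f c%:MP = g c%:MP) -> (forall i, f 'X_i = g 'X_i) -> f =1 g.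
Proof.
move=> fgC fgX p; rewrite [p]mpolyE !rmorph_sum /=; apply: eq_bigr => a _.
rewrite -mul_mpolyC !rmorphM fgC mpolyXE_id !rmorph_prod; congr (_ * _).
by apply: eq_bigr => i _; rewrite !rmorphXn fgX.
Qed.

Section RationalFunctions.
Variables (F : fieldType) (I : finType).
Local Notation R := {mpoly F[#|I|]}.

Definition ratpoly : {rmorphism R -> ratfun F I} := @FracField.tofrac R.
Definition ratconst : {rmorphism F -> ratfun F I} := const_frac ratpoly.

Lemma ratpoly_inj : injective ratpoly.
Proof. by move=> x y /eqP; rewrite /ratpoly tofrac_eq => /eqP. Qed.

Lemma ratpolyP x : exists a e, e != 0 /\ x = ratpoly a / ratpoly e.
Proof. exact: fracP. Qed.

Lemma ratpolyC c : ratpoly c%:MP = ratconst c. Proof. by []. Qed.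

Lemma ratpolyX i : ratpoly 'X_(enum_rank i) = ratvar F i. Proof. by []. Qed.

Lemma ratpoly_lift (L : fieldType) (f : {rmorphism R -> L}) : injective f ->
  exists g : {rmorphism ratfun F I -> L}, forall x, g (ratpoly x) = f x.
Proof. exact: frac_lift. Qed.

Definition rateval (S : comNzRingType) (phi : {rmorphism F -> S}) (h : I -> S) :
  {rmorphism R -> S} := mmap phi (h \o enum_val).

Lemma ratevalC (S : comNzRingType) (phi : {rmorphism F -> S}) h c :
  rateval phi h c%:MP = phi c.
Proof. exact: mmapC. Qed.

Lemma ratevalX (S : comNzRingType) (phi : {rmorphism F -> S}) h i :
  rateval phi h 'X_(enum_rank i) = h i.
Proof. by rewrite /rateval /= mmapX mmap1U /= enum_rankK. Qed.

Lemma eq_rmorph_rat (S : comNzRingType) (f g : {rmorphism R -> S}) :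
  (forall c, f c%:MP = g c%:MP) ->
  (forall i : I, f 'X_(enum_rank i) = g 'X_(enum_rank i)) -> f =1 g.
Proof.
move=> fgC fgX; apply: eq_rmorph_mpoly => // i.
by rewrite -(enum_valK i); apply: fgX.
Qed.

End RationalFunctions.

Opaque ratpoly ratconst rateval.

Section GenericMinors.
Variables (F : fieldType) (d m : nat).

(** The determinant is a polynomial in the variables, and it takes the value 1 where the chosen
    columns form the identity matrix. *)
Lemma generic_minor_unit (e : 'I_d -> 'I_m) :
  injective e -> colsub e (generic_mx F d m) \in unitmx.
Proof.
move=> inje; rewrite unitmxE unitfE.
pose X : 'M[{mpoly F[#|generic_index d m|]}]_d :=
  \matrix_(i, j) 'X_(enum_rank ((i, e j) : generic_index d m)).
have -> : colsub e (generic_mx F d m) =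
    map_mx (ratpoly F (generic_index d m)) X.
  by apply/matrixP => i j; rewrite !mxE ratpolyX.
rewrite det_map_mx -(rmorph0 (ratpoly F (generic_index d m))).
rewrite (inj_eq (@ratpoly_inj _ _)); apply/eqP => X0.
pose v := rateval idfun (fun x : generic_index d m => (e x.1 == x.2)%:R : F).
have : v (\det X) == 0 by rewrite X0 rmorph0.
rewrite -det_map_mx; suff -> : map_mx v X = 1%:M by rewrite det1 oner_eq0.
by apply/matrixP => i j; rewrite !mxE ratevalX /= (inj_eq inje).
Qed.

End GenericMinors.

(** * Embeddings relating the generic and the normalized matrix *)

Section Normalization.
Variables (F : fieldType) (d m : nat) (ledm : (d <= m)%N).

Local Notation gidx := (generic_index d m).
Local Notation nidx := (normal_index d m).
Local Notation k := (ratfun F gidx).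
Local Notation k' := (ratfun F nidx).
Local Notation G := {mpoly F[#|gidx|]}.
Local Notation N := {mpoly F[#|nidx|]}.
Local Notation gen := (generic_mx F d m).
Local Notation nor := (normal_generic_mx F d m).
Local Notation gvar i j := ('X_(enum_rank ((i, j) : gidx)) : G).

Let B : 'M[k]_d := colsub (widen_ord ledm) gen.

Let uB : B \in unitmx.
Proof.
by apply: generic_minor_unit => i j /(congr1 val)/= ij; apply: val_inj.
Qed.

Let genE i j : ratpoly F gidx (gvar i j) = gen i j.
Proof. by rewrite ratpolyX mxE. Qed.

Let left_block i (j : 'I_m) (ltjd : (j < d)%N) :
  (invmx B *m gen) i j = (i == j :> nat)%:R.
Proof.
have Ej : widen_ord ledm (Ordinal ltjd) = j by apply: val_inj.
have := congr1 (fun A : 'M_d => A i (Ordinal ltjd)) (mulVmx uB).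
by rewrite mulmx_colsub !mxE Ej => ->.
Qed.

(* The substitution (B | A0) |-> (B | B A0); it is injective because
   (B | A0) |-> (B | B^-1 A0) undoes it. *)
Let twist_var (x : gidx) : G :=
  if (x.2 < d)%N then gvar x.1 x.2
  else \sum_l gvar x.1 (widen_ord ledm l) * gvar l x.2.

Let twist : {rmorphism G -> G} := rateval (@mpolyC _ F) twist_var.

Let twist_inj : injective twist.
Proof.
(* Undoing the substitution needs the inverse of [B], so the values lie in [k], and the composite is
   the embedding of [G] in [k] rather than the identity. *)
pose untwist := rateval (ratconst F gidx) (fun x : gidx =>
    if (x.2 < d)%N then gen x.1 x.2 else (invmx B *m gen) x.1 x.2).
have E : untwist \o twist =1 ratpoly F gidx.
  apply: eq_rmorph_rat => [c|[i j]] /=.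
    by rewrite /twist ratevalC /untwist /= ratevalC ratpolyC.
  rewrite /twist ratevalX /twist_var /= genE; case: ifP => [ltjd|gejd].
    by rewrite /untwist ratevalX /= ltjd.
  rewrite (rmorph_sum untwist) -[gen in RHS](mulKVmx uB) [RHS]mxE.
  apply: eq_bigr => l _; rewrite (rmorphM untwist) /untwist !ratevalX /=.
  by rewrite ltn_ord gejd; congr (_ * _); rewrite [RHS]mxE.
by move=> p q pq; apply: (@ratpoly_inj F gidx); rewrite -!E /= pq.
Qed.

Let normal_eval : {rmorphism N -> k} :=
  rateval (ratconst F gidx) (fun x : nidx => (invmx B *m gen) x.1 (val x.2)).

(** This is the algebraic independence of the entries of [B^-1 A0]. Extended to fractions, [twist]
    fixes [B] and sends [A0] to [B A0], hence sends [B^-1 A0] back to [A0]; the composite is thus an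
    inclusion of polynomial rings. *)
Let normal_eval_inj : injective normal_eval.
Proof.
have [theta thetaE] := ratpoly_lift (f := ratpoly F gidx \o twist)
  (inj_comp (@ratpoly_inj F gidx) twist_inj).
have thetaX i j : theta (gen i j) = ratpoly F gidx (twist_var (i, j)).
  by rewrite -genE thetaE /= /twist ratevalX.
pose rename : {rmorphism N -> G} :=
  rateval (@mpolyC _ F) (fun x : nidx => gvar x.1 (val x.2)).
(* A left inverse of [rename], sending the variables of the block [B] to 0. *)
pose restrict : {rmorphism G -> N} := rateval (@mpolyC _ F) (fun x : gidx =>
    if insub x.2 is Some j then 'X_(enum_rank ((x.1, j) : nidx)) else 0).
have renameK : restrict \o rename =1 idfun.
  apply: eq_rmorph_rat => [c|[i j]] /=.
    by rewrite /rename ratevalC /restrict /= ratevalC.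
  by rewrite /rename ratevalX /restrict /= ratevalX /= valK.
have thetaB : map_mx theta B = B.
  by apply/matrixP => i j; rewrite mxE mxE thetaX /twist_var /= ltn_ord genE.
have E : theta \o normal_eval =1 ratpoly F gidx \o rename.
  apply: eq_rmorph_rat => [c|[i [j gejd]]] /=.
    rewrite /normal_eval ratevalC /rename ratevalC ratpolyC.
    by rewrite -[in LHS]ratpolyC thetaE /= /twist ratevalC ratpolyC.
  rewrite /normal_eval ratevalX /rename ratevalX /= genE.
  have -> : theta ((invmx B *m gen) i j) = map_mx theta (invmx B *m gen) i j.
    by rewrite [RHS]mxE.
  rewrite (map_mxM theta) (map_invmx theta) thetaB -[gen in RHS](mulKmx uB).
  rewrite mxE [RHS]mxE.
  apply: eq_bigr => l _; congr (_ * _).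
  rewrite mxE [RHS]mxE thetaX /twist_var /=.
  rewrite ltnNge gejd /= rmorph_sum; apply: eq_bigr => r _.
  by rewrite rmorphM /= !genE [RHS in _ = RHS * _]mxE.
move=> p q pq; apply: (can_inj (f := rename) (g := restrict) renameK).
apply: (@ratpoly_inj F gidx).
by rewrite -[LHS]E -[RHS]E /= pq.
Qed.

(** The clause on constants serves the next embedding, where two morphisms are compared on
    coefficients in [F]. *)
Lemma normal_to_generic : exists phi : {rmorphism k' -> k},
  (forall c, phi (ratconst F nidx c) = ratconst F gidx c) /\
  map_mx phi nor = invmx (colsub (widen_ord ledm) gen) *m gen.
Proof.
have [phi phiE] := ratpoly_lift normal_eval_inj; exists phi; split=> [c|].
  by rewrite -ratpolyC phiE /normal_eval ratevalC.
apply/matrixP => i j; rewrite mxE [nor i j]mxE.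
case: insubP => [j' _ <-|]; last first.
  by rewrite -ltnNge => ltjd; rewrite left_block // rmorph_nat.
by rewrite -ratpolyX phiE /normal_eval ratevalX.
Qed.

(** The map sends [(B | A0)] to [b (I | A)] with fresh variables [b]. It is injective because
    specializing [b] to [B] and [A] to [B^-1 A0] gives [(B | A0)] back. *)
Lemma generic_to_normal :
  exists psi : {rmorphism k -> ratfun k' (generic_index d d)},
  map_mx psi gen =
    generic_mx k' d d *m map_mx (ratconst k' (generic_index d d)) nor.
Proof.
have [phi [phiC phiN]] := normal_to_generic.
pose P := {mpoly k'[#|generic_index d d|]}.
pose b : 'M[P]_d := \matrix_(i, l) 'X_(enum_rank ((i, l) : generic_index d d)).
pose f : {rmorphism G -> P} := rateval (@mpolyC _ k' \o ratconst F nidx)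
    (fun x : gidx => (b *m map_mx (@mpolyC _ k') nor) x.1 x.2).
pose g : {rmorphism P -> k} :=
  rateval phi (fun x : generic_index d d => B x.1 x.2).
have E : g \o f =1 ratpoly F gidx.
  apply: eq_rmorph_rat => [c|[i j]] /=.
    by rewrite /f ratevalC /g /= ratevalC phiC ratpolyC.
  rewrite /f ratevalX genE /= -[gen in RHS](mulKVmx uB) [RHS]mxE -phiN mxE.
  rewrite (rmorph_sum g); apply: eq_bigr => l _.
  rewrite (rmorphM g) mxE (mxE _ _ l j) /g ratevalX ratevalC /=.
  by congr (_ * _); rewrite [RHS]mxE.
have injf : injective f.
  by move=> p q pq; apply: (@ratpoly_inj F gidx); rewrite -[LHS]E -[RHS]E /= pq.
have [psi psiE] := ratpoly_lift
  (f := ratpoly k' (generic_index d d) \o f)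
  (inj_comp (@ratpoly_inj k' (generic_index d d)) injf).
exists psi; apply/matrixP => i j.
rewrite mxE -genE psiE /= /f ratevalX /= mxE [RHS]mxE rmorph_sum.
by apply: eq_bigr => l _; rewrite rmorphM /= mxE ratpolyX !mxE ratpolyC.
Qed.

End Normalization.

Theorem lemma3p1 (F : fieldType) (d m : nat) (D : {set {set 'I_m}})
    (D_complex : complex_on_vertices D) (D_sphere : homology_sphere F d D) :
  [/\ is_lsop D (generic_mx F d m),
      is_lsop D (normal_generic_mx F d m)
    & anisotropic D (generic_mx F d m) <->
      anisotropic D (normal_generic_mx F d m)].
Proof.
have [D0 _ _] := D_complex.
have pureD s := @homology_sphere_pure F d m D s D0 D_sphere.
have ledm : (d <= m)%N.
  have [t [_ _ <-]] := pureD _ D0.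
  by have := max_card (mem t); rewrite card_ord.
have uB : colsub (widen_ord ledm) (generic_mx F d m) \in unitmx.
  by apply: generic_minor_unit => i j /(congr1 val)/= ij; apply: val_inj.
have [phi [_ phiE]] := normal_to_generic F ledm.
have [psi psiE] := generic_to_normal F ledm.
split.
- exact: lsop_minors D0 pureD (@generic_minor_unit F d m).
(* In [k], a maximal square submatrix of the normalized matrix becomes [B^-1] times the generic one
   on the same columns. *)
- apply: (lsop_minors D0 pureD) => e inje; rewrite -(map_unitmx phi).
  have -> : map_mx phi (colsub e (normal_generic_mx F d m)) =
      colsub e (map_mx phi (normal_generic_mx F d m)).
    by apply/matrixP => i j; rewrite !mxE.
  by rewrite phiE -mulmx_colsub unitmx_mul unitmx_inv uB generic_minor_unit.
split=> aM.
  (* From [k] to [k']: replace the generic matrix by its multiple by [B^-1], then descend. *)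
  apply: (anisotropic_descent (phi := phi)).
  by rewrite phiE anisotropic_unitmx ?unitmx_inv.
(* From [k'] to [k]: ascend to [k'(b)], multiply by the invertible matrix [b], then descend along
   [psi]. *)
apply: (anisotropic_descent (phi := psi)); rewrite psiE anisotropic_unitmx.
  exact: (anisotropic_frac (@ratpoly_inj _ _) (@ratpolyP _ _)).
have -> : generic_mx (ratfun F (normal_index d m)) d d =
    colsub id (generic_mx _ d d).
  by apply/matrixP => i j; rewrite [RHS]mxE.
exact: generic_minor_unit.
Qed.
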